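(* Let $k\ge1$ and $a\ge1$ be integers. Then $$\operatorname{vol}\mathcal F_{\mathrm{MCar}^{(k)}_{a+2}}(1,0,\ldots,0,-1)=\mathrm{Cat}(a,ka-1).$$
   Context: The $k$-multicaracol graph $\mathrm{MCar}^{(k)}_{a+2}$ is the directed multigraph on vertex set $\{0,1,\ldots,a+1\}$ whose edges are: $(i,i+1)$ for $1\le i\le a$, $(i,a+1)$ for $1\le i\le a-1$ (these form the Pitman--Stanley graph $\mathrm{PS}_{a+1}$ on $\{1,\ldots,a+1\}$), and $k$ distinct parallel edges $(0,i)$ for each $i=1,\ldots,a$; edges are directed from smaller to larger vertex. For a net flow vector $\mathbf a=(a_0,a_1,\ldots,a_a,-\sum a_i)$ with $a_i\ge0$ (indexed by the vertices), $\mathcal F_G(\mathbf a)$ is the set of $(f_e)_{e\in E}\in\mathbb R^E_{\ge0}$ (one coordinate per edge, parallel edges counted separately) such that at each vertex $j\le a$ the outflow minus the inflow equals $a_j$. The normalized volume of a $d$-dimensional polytope is $d!$ times its relative volume with respect to the integer lattice. $\mathrm{Cat}(a,b)=\frac1{a+b}\binom{a+b}{a}$. *)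

(* Defs.v *)
From HB Require Import structures.
From mathcomp Require Import all_boot all_order all_algebra.
From mathcomp Require Import all_classical all_reals all_analysis.

Set Implicit Arguments.
Unset Strict Implicit.
Unset Printing Implicit Defensive.

Import Order.TTheory GRing.Theory Num.Theory.

Local Open Scope classical_set_scope.
Local Open Scope ring_scope.

(** A directed multigraph on the vertices 0, ..., n: edges form a type of their
    own, so distinct edges may share both endpoints. *)
Record multidigraph (n : nat) := Multidigraph {
  edge : finType ;
  src : edge -> 'I_n.+1 ;
  tgt : edge -> 'I_n.+1 }.

Definition flow_polytope (R : realType) (n : nat) (G : multidigraph n)
    (netflow : 'I_n.+1 -> R) : set (edge G -> R) :=
  [set f | (forall e, 0 <= f e) /\
    forall j : 'I_n.+1, (j < n)%N ->
      \sum_(e : edge G | src e == j) f e - \sum_(e : edge G | tgt e == j) f e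
      = netflow j].

(** Ordinals start at 0, so the ordinal i stands for the index i + 1:
    - inl (inl i) is the edge (i+1, i+2), for 1 <= i+1 <= a;
    - inl (inr i) is the edge (i+1, a+1), for 1 <= i+1 <= a-1;
    - inr (i, m) is the m-th of the k parallel edges (0, i+1), 1 <= i+1 <= a. *)
Definition mcar_edge (k a : nat) : finType := ('I_a + 'I_a.-1 + 'I_a * 'I_k)%type.

Definition mcar_src (k a : nat) (e : mcar_edge k a) : 'I_a.+2 :=
  match e with
  | inl (inl i) => inord i.+1
  | inl (inr i) => inord i.+1
  | inr _ => ord0
  end.

Definition mcar_tgt (k a : nat) (e : mcar_edge k a) : 'I_a.+2 :=
  match e with
  | inl (inl i) => inord i.+2
  | inl (inr _) => ord_max
  | inr (i, _) => inord i.+1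
  end.

Definition MCar (k a : nat) : multidigraph a.+1 :=
  Multidigraph (@mcar_src k a) (@mcar_tgt k a).

(** The vector (1, 0, ..., 0, -1). *)
Definition unit_netflow (R : realType) (n : nat) (j : 'I_n.+2) : R :=
  if j == ord0 then 1 else if j == ord_max then -1 else 0.

(** Lebesgue measure on R^d, as the d-fold product of [lebesgue_measure]; [\x]
    is the product measure, and R^(d+1) is identified with R * R^d. *)
Fixpoint lebesgue_tuple (R : realType) (d : nat) : set (d.-tuple R) -> \bar R :=
  match d with
  | 0 => \d_[tuple]
  | d'.+1 => fun A =>
      (lebesgue_measure \x @lebesgue_tuple R d')%E
        [set p : R * d'.-tuple R | A [tuple of p.1 :: p.2]]
  end.

Section relative_volume.
Variables (R : realType) (E : finType).
Implicit Types (P : set (E -> R)).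

Definition affine_hull P : set (E -> R) :=
  [set x | exists (n : nat) (w : 'I_n -> R) (y : 'I_n -> E -> R),
    [/\ forall i, P (y i), \sum_i w i = 1 &
        forall e, x e = \sum_i w i * y i e]].

(** The linear space parallel to the affine hull of P. *)
Definition direction P : set (E -> R) :=
  [set u | exists x y, [/\ affine_hull P x, affine_hull P y &
                           forall e, u e = x e - y e]].

(** B is a Z-basis of the lattice (direction P) ∩ Z^E, and this lattice has full
    rank in [direction P]; hence d is the dimension of P. *)
Definition lattice_basis P (d : nat) (B : 'I_d -> E -> int) : Prop :=
  [/\ forall i, direction P (fun e => (B i e)%:~R),
      forall z : E -> int, direction P (fun e => (z e)%:~R) ->
        exists c : 'I_d -> int, forall e, z e = \sum_i c i * B i e,
      forall c : 'I_d -> int,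
        (forall e, \sum_i c i * B i e = 0) -> forall i, c i = 0 &
      forall u, direction P u ->
        exists t : 'I_d -> R, forall e, u e = \sum_i t i * (B i e)%:~R].

(** The relative volume of P is the Lebesgue measure of P read in the affine
    coordinates given by a point of its affine hull and a lattice basis; it does
    not depend on these choices, since two coordinate systems differ by a
    translation and an element of GL_d(Z). *)
Definition has_normalized_volume P (v : \bar R) : Prop :=
  exists (d : nat) (p : E -> R) (B : 'I_d -> E -> int),
    [/\ affine_hull P p, lattice_basis P B &
        v = ((d`!)%:R%:E * lebesgue_tuple
              [set t : d.-tuple R |
                P (fun e => (p e + \sum_i tnth t i * (B i e)%:~R)%R)])%E].

End relative_volume.

Definition Cat (R : realType) (a b : nat) : R :=
  (a + b)%:R^-1 * 'C(a + b, a)%:R.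

(* Main.v *)
Require Import Defs.
From mathcomp Require Import all_boot all_order all_algebra.
From mathcomp Require Import all_classical all_reals all_analysis.
From mathcomp Require Import ring lra zify.

(** Let S_l be the flow on the last l edges out of vertex 0 and Z_j the flow on
    the last j edges into the sink.  A unit flow is determined by these partial
    sums, and nonnegativity of the flow becomes
      0 = S_0 <= S_1 <= ... <= S_(ka) = 1,  0 = Z_0 <= Z_1 <= ... <= Z_a = 1,
      S_(kj) <= Z_j  for 0 < j < a.
    Some flow makes all these inequalities strict, so the affine hull of the
    polytope is cut out by the conservation laws alone, and the other partial
    sums are unimodular coordinates on it.  Integrate in the order S_1, ...,
    S_(k-1), Z_1, S_k, ..., S_(2k-1), Z_2, S_(2k), ... (innermost first).  With
    i variables S and j variables Z integrated out, the result as a function of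
    the next variables s <= z of the two chains is
      s^i z^j / (i! j!) - k s^(i+1) z^(j-1) / ((i+1)! (j-1)!):
    an S-step integrates over [0, s]; a Z-step integrates over [s, z] and
    happens when i + 1 = k (j + 1), which is exactly when the new polynomial
    vanishes on the diagonal s = z.  At i = ka - 1, j = a - 1, s = z = 1 this is
    Cat(a, ka - 1) / (ka + a - 2)!. *)

Set Implicit Arguments.
Unset Strict Implicit.
Unset Printing Implicit Defensive.

Import Order.TTheory GRing.Theory Num.Theory.
Import numFieldNormedType.Exports.

Local Open Scope classical_set_scope.
Local Open Scope ring_scope.

Section LebesgueTuple.
Variable R : realType.
Local Notation mu := (@lebesgue_measure R).

Lemma lebesgue_tuple0 (A : set (0.-tuple R)) :
  A [tuple] -> lebesgue_tuple A = 1%E.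
Proof. by move=> A_nil; rewrite /= diracE mem_set. Qed.

Lemma lebesgue_tupleS (n : nat) (A : set (n.+1.-tuple R)) :
  lebesgue_tuple A =
  (\int[mu]_x lebesgue_tuple [set t : n.-tuple R | A [tuple of x :: t]])%E.
Proof.
rewrite /= /product_measure1; apply: eq_integral => x _ /=.
congr (lebesgue_tuple _); apply/seteqP; split=> t /=.
  by rewrite /xsection /= inE.
by move=> At; rewrite /xsection /= inE.
Qed.

Lemma lebesgue_tuple_set0 (n : nat) :
  lebesgue_tuple (set0 : set (n.-tuple R)) = 0%E.
Proof.
elim: n => [|n IHn]; first by rewrite /= measure0.
by rewrite lebesgue_tupleS integral0_eq // => x _; rewrite -[RHS]IHn.
Qed.

Lemma lebesgue_tuple_slices (n : nat) (A : R -> set (n.-tuple R)) (a b : R) :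
  lebesgue_tuple [set t : n.+1.-tuple R |
    a <= thead t <= b /\ A (thead t) [tuple of behead t]] =
  (\int[mu]_(x in `[a, b]) lebesgue_tuple (A x))%E.
Proof.
rewrite lebesgue_tupleS [RHS]integral_mkcond; apply: eq_integral => x _.
rewrite patchE; case: ifPn => x_in.
  congr (lebesgue_tuple _); apply/seteqP; split=> t /=.
    by rewrite theadE => -[_]; congr (A _ _); apply: val_inj.
  move=> At; move: x_in; rewrite inE /= in_itv /= theadE => ->; split=> //.
  by congr (A _ _): At; apply: val_inj.
rewrite -[RHS](lebesgue_tuple_set0 n); congr (lebesgue_tuple _).
apply/seteqP; split=> t //=; rewrite theadE => -[x_in' _].
by move: x_in; rewrite notin_setE /= in_itv /= x_in'.
Qed.

Lemma integral_deriv_poly (p : {poly R}) (a b : R) : a <= b ->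
  (\int[mu]_(x in `[a, b]) (p^`().[x])%:E)%E = (p.[b] - p.[a])%:E.
Proof.
rewrite le_eqVlt => /predU1P[->|ab].
  by rewrite set_itv1 integral_set1 subrr.
have p_continuous (q : {poly R}) : continuous (horner q).
  by apply: continuous_horner.
rewrite (@continuous_FTC2 _ _ (horner p)) //.
- by apply: continuous_subspaceT => x; exact: p_continuous.
- split=> [x _||]; first exact: derivable_horner.
    by apply: cvg_at_right_filter; exact: p_continuous.
  by apply: cvg_at_left_filter; exact: p_continuous.
- by move=> x _; rewrite derivE.
Qed.

End LebesgueTuple.

Section Positions.
Variable k : nat.
Hypothesis k_gt0 : (0 < k)%N.

(** The order of integration, innermost first: [S_l] is at position
    [source_pos l] and [Z_j] at position [sink_pos j], just before [S_(k j)].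
    Position 0 stands for both [S_0] and [Z_0].  The ranks count the positions
    1, ..., [r] of each kind. *)
Definition source_pos (l : nat) : nat := (l + l %/ k)%N.
Definition sink_pos (j : nat) : nat := (k.+1 * j).-1.

Definition is_sink_pos (r : nat) : bool := (k.+1 %| r.+1)%N.
Definition next_source_pos (r : nat) : nat := (r.+1 + is_sink_pos r.+1)%N.

Definition sink_rank (r : nat) : nat := (r.+1 %/ k.+1)%N.
Definition source_rank (r : nat) : nat := (r - sink_rank r)%N.

Lemma source_pos0 : source_pos 0 = 0%N.
Proof. by rewrite /source_pos div0n. Qed.

Lemma sink_pos0 : sink_pos 0 = 0%N.
Proof. by rewrite /sink_pos muln0. Qed.

Lemma source_posMD (q m : nat) : (m < k)%N ->
  source_pos (k * q + m) = (k.+1 * q + m)%N.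
Proof.
by move=> mk; rewrite /source_pos mulnC divnMDl // divn_small //; lia.
Qed.

Lemma source_posM (q : nat) : source_pos (k * q) = (k.+1 * q)%N.
Proof. by have := source_posMD q k_gt0; rewrite !addn0. Qed.

Lemma succ_sink_pos (j : nat) : (0 < j)%N ->
  (sink_pos j).+1 = source_pos (k * j).
Proof. by move=> j_gt0; rewrite source_posM prednK // muln_gt0. Qed.

Lemma sink_posS (j : nat) : (0 < j)%N ->
  sink_pos j.+1 = (sink_pos j + k.+1)%N.
Proof.
move=> j_gt0; apply: succn_inj.
by rewrite -addSn !succ_sink_pos // !source_posM mulnS addnC.
Qed.

Lemma leq_source_pos : {mono source_pos : l l' / (l <= l')%N}.
Proof.
apply: leq_mono => l l' ll'; rewrite /source_pos -addSn leq_add //.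
exact/leq_div2r/ltnW.
Qed.

Lemma leq_sink_pos (j j' : nat) : (0 < j)%N ->
  (sink_pos j <= sink_pos j')%N = (j <= j')%N.
Proof.
case: j => // j _; case: j' => [|j'].
  by rewrite sink_pos0 leqn0 /sink_pos mulnS addSn /= addn_eq0 (gtn_eqF k_gt0).
by rewrite /sink_pos !mulnS !addSn /= !leq_add2l leq_pmul2l.
Qed.

Lemma is_sink_pos_sink (j : nat) : (0 < j)%N -> is_sink_pos (sink_pos j).
Proof.
by move=> j_gt0; rewrite /is_sink_pos succ_sink_pos // source_posM dvdn_mulr.
Qed.

Lemma is_sink_pos_source (l : nat) : is_sink_pos (source_pos l) = false.
Proof.
rewrite /is_sink_pos (divn_eq l k) mulnC; have := ltn_pmod l k_gt0.
by move=> mk; rewrite source_posMD // -addnS dvdn_addr ?dvdn_mulr // gtnNdvd.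
Qed.

Lemma is_sink_posS (r : nat) : is_sink_pos r -> is_sink_pos r.+1 = false.
Proof.
move=> r_sink; rewrite /is_sink_pos -[r.+2]addn1 dvdn_addr //.
by rewrite dvdn1 eqSS gtn_eqF.
Qed.

Lemma is_sink_posD (r : nat) : is_sink_pos (r + k.+1) = is_sink_pos r.
Proof. by rewrite /is_sink_pos -addSn dvdn_addl. Qed.

Lemma is_sink_pos_gap (r r' : nat) : is_sink_pos r -> is_sink_pos r' ->
  (r < r')%N -> (r + k.+1 <= r')%N.
Proof.
move=> r_sink r'_sink rr'; have := dvdn_sub r'_sink r_sink.
by rewrite subSS => /dvdn_leq; rewrite subn_gt0 => /(_ rr'); lia.
Qed.

Lemma ltn_next_source_pos (r : nat) : (r < next_source_pos r)%N.
Proof. exact: leq_addr. Qed.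

Lemma is_sink_pos_next_source (r : nat) :
  is_sink_pos (next_source_pos r) = false.
Proof.
rewrite /next_source_pos; case: (boolP (is_sink_pos r.+1)) => [r_sink|/negbTE].
  by rewrite addn1 is_sink_posS.
by rewrite addn0.
Qed.

Lemma next_source_pos_source (l : nat) :
  next_source_pos (source_pos l) = source_pos l.+1.
Proof.
suff sinkE : is_sink_pos (source_pos l).+1 = (k %| l.+1)%N.
  rewrite /next_source_pos sinkE /source_pos divnS //.
  by rewrite addSn -addnA [(_ + l %/ k)%N]addnC.
rewrite /is_sink_pos (divn_eq l k) mulnC; have := ltn_pmod l k_gt0.
move: (l %/ k)%N (l %% k)%N => q m mk.
rewrite source_posMD // -!addnS (dvdn_addr _ (dvdn_mulr _ (dvdnn _))).
rewrite (dvdn_addr _ (dvdn_mulr _ (dvdnn _))).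
have [->|mk'] := eqVneq m.+1 k; first by rewrite !dvdnn.
by rewrite !gtnNdvd ?ltnS // ltn_neqAle mk'.
Qed.

Variant position_spec : nat -> Prop :=
  | SourcePosition l of (0 < l)%N : position_spec (source_pos l)
  | SinkPosition j of (0 < j)%N : position_spec (sink_pos j).

Lemma positionP (r : nat) : (0 < r)%N -> position_spec r.
Proof.
move=> r_gt0; have [r_sink|r_source] := boolP (is_sink_pos r).
  have <- : sink_pos (r.+1 %/ k.+1) = r by rewrite /sink_pos mulnC divnK.
  by constructor; rewrite divn_gt0 // dvdn_leq.
have m_gt0 : (0 < r.+1 %% k.+1)%N by rewrite lt0n.
have mk : (r.+1 %% k.+1 < k.+1)%N by rewrite ltn_pmod.
have rE : source_pos (k * (r.+1 %/ k.+1) + (r.+1 %% k.+1).-1) = r.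
  by have := divn_eq r.+1 k.+1; rewrite source_posMD; lia.
rewrite -rE; constructor; rewrite lt0n; apply: contraTneq r_gt0 => l0.
by rewrite -rE l0 source_pos0.
Qed.

Lemma source_posK : cancel source_pos source_rank.
Proof.
move=> l; rewrite /source_rank /sink_rank (divn_eq l k).
have := ltn_pmod l k_gt0; move: (l %/ k)%N (l %% k)%N => q m mk.
rewrite mulnC source_posMD // -addnS [(k.+1 * q)%N]mulnC.
by rewrite divnMDl // divn_small //; lia.
Qed.

Lemma sink_posK (j : nat) : (0 < j)%N -> sink_rank (sink_pos j) = j.
Proof.
by move=> j_gt0; rewrite /sink_rank succ_sink_pos // source_posM mulKn.
Qed.

End Positions.

Section DividedPowers.
Variable R : numFieldType.

Lemma natr_fact_neq0 (n : nat) : n`!%:R != 0 :> R.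
Proof. by rewrite pnatr_eq0 -lt0n fact_gt0. Qed.

Definition divided_power (n : nat) : {poly R} := n`!%:R^-1 *: 'X^n.

Lemma deriv_divided_power0 : (divided_power 0)^`() = 0.
Proof. by rewrite /divided_power expr0 alg_polyC derivC. Qed.

Lemma deriv_divided_powerS (n : nat) :
  (divided_power n.+1)^`() = divided_power n.
Proof.
rewrite /divided_power derivZ derivXn -scalerMnr scalerMnl; congr (_ *: _).
by rewrite factS natrM invfM -mulr_natr mulrAC mulVf ?mul1r ?pnatr_eq0.
Qed.

Lemma horner_divided_power (n : nat) (x : R) :
  (divided_power n).[x] = x ^+ n / n`!%:R.
Proof. by rewrite /divided_power hornerZ hornerXn mulrC. Qed.

End DividedPowers.

Arguments divided_power {R}.

Section BallotPolynomials.
Variables (R : realType) (k : nat).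
Hypothesis k_gt0 : (0 < k)%N.
Local Notation mu := (@lebesgue_measure R).

(** [s^i z^j / (i! j!) - k s^(i+1) z^(j-1) / ((i+1)! (j-1)!)], the continuous
    analogue of the ballot number ['C(i + j, j) - k * 'C(i + j, j - 1)]; the
    derivative makes the last term vanish for [j = 0]. *)
Definition ballot_poly (i j : nat) (s z : R) : R :=
  (divided_power i).[s] * (divided_power j).[z] -
  k%:R * (divided_power i.+1).[s] * ((divided_power j)^`()).[z].

Lemma ballot_poly00 (s z : R) : ballot_poly 0 0 s z = 1.
Proof.
rewrite /ballot_poly deriv_divided_power0 horner0 mulr0 subr0.
by rewrite !horner_divided_power !expr0 fact0 divr1 mulr1.
Qed.

Lemma integral_ballot_poly_lower (i j : nat) (s z : R) : 0 <= s ->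
  (\int[mu]_(x in `[0%R, s]) (ballot_poly i j x z)%:E)%E =
  (ballot_poly i.+1 j s z)%:E.
Proof.
move=> s_ge0; set c := ((divided_power j)^`()).[z].
pose p := (divided_power j).[z] *: divided_power i.+1
          - (k%:R * c) *: divided_power i.+2.
have -> : ballot_poly i.+1 j s z = p.[s] - p.[0].
  rewrite /ballot_poly /p -/c.
  rewrite !(horner_divided_power, hornerD, hornerN, hornerZ) !expr0n /=.
  by ring.
rewrite -integral_deriv_poly //; apply: eq_integral => x _; congr _%:E.
rewrite /p derivB derivZ [X in _ - X]derivZ !deriv_divided_powerS.
rewrite /ballot_poly -/c.
by rewrite !(horner_divided_power, hornerD, hornerN, hornerZ); ring.
Qed.

Lemma ballot_poly_diag (i j : nat) (s : R) : i.+1 = (k * j.+1)%N ->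
  ballot_poly i j.+1 s s = 0.
Proof.
move=> ijE; have ijER : i.+1%:R = k%:R * j.+1%:R :> R by rewrite ijE natrM.
have k_neq0 : k%:R != 0 :> R by rewrite pnatr_eq0 -lt0n.
have j_neq0 : j.+1%:R != 0 :> R by rewrite pnatr_eq0.
rewrite /ballot_poly deriv_divided_powerS !horner_divided_power.
rewrite !factS !natrM !exprS ijER.
by field; rewrite !natr_fact_neq0 nat1r k_neq0 j_neq0.
Qed.

Lemma integral_ballot_poly_upper (i j : nat) (s z : R) :
  i.+1 = (k * j.+1)%N -> s <= z ->
  (\int[mu]_(x in `[s, z]) (ballot_poly i j s x)%:E)%E =
  (ballot_poly i j.+1 s z)%:E.
Proof.
move=> ijE sz.
pose p := (divided_power i).[s] *: divided_power j.+1
          - (k%:R * (divided_power i.+1).[s]) *: divided_power j.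
have pE x : p.[x] = ballot_poly i j.+1 s x.
  rewrite /ballot_poly /p deriv_divided_powerS.
  by rewrite !(horner_divided_power, hornerD, hornerN, hornerZ).
rewrite -pE -[p.[z]]subr0 -(ballot_poly_diag s ijE) -pE -integral_deriv_poly //.
apply: eq_integral => x _; congr _%:E.
rewrite /p derivB derivZ [X in _ - X]derivZ deriv_divided_powerS /ballot_poly.
by rewrite !(horner_divided_power, hornerD, hornerN, hornerZ).
Qed.

Lemma ballot_poly_Cat (a : nat) :
  (k * a.+1 + a - 1)`!%:R * ballot_poly (k * a.+1 - 1) a 1 1 =
  Cat R a.+1 (k * a.+1 - 1).
Proof.
have [m mE] : exists m, (k * a.+1 = m.+1)%N.
  by exists (k * a.+1).-1; rewrite prednK // muln_gt0 k_gt0.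
have mER : m.+1%:R = k%:R * a.+1%:R :> R by rewrite -mE natrM.
have k_neq0 : k%:R != 0 :> R by rewrite pnatr_eq0 -lt0n.
have binE :
    'C((a + m).+1, a.+1)%:R = (a + m).+1`!%:R / (a.+1`!%:R * m`!%:R) :> R.
  rewrite -(@bin_fact (a + m).+1 a.+1) ?ltnS ?leq_addr // subSS addKn.
  by rewrite natrM [(_ * m`!)%:R]natrM mulfK // mulf_neq0 ?natr_fact_neq0.
rewrite /Cat /ballot_poly mE !subn1 !addSn /= binE [(a + m)%N]addnC.
rewrite !horner_divided_power !expr1n.
case: a {mE binE} mER => [|a] mER.
  rewrite deriv_divided_power0 horner0 mulr0 subr0 !addn0 !factS fact0 !natrM.
  by field; rewrite natr_fact_neq0 nat1r pnatr_eq0.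
rewrite deriv_divided_powerS horner_divided_power expr1n !factS !natrM mER.
by field; rewrite !natr_fact_neq0 k_neq0 !nat1r -!natrD nat1r !pnatr_eq0.
Qed.

End BallotPolynomials.

Section LinkedChains.
Variables (R : realType) (k : nat).
Hypothesis k_gt0 : (0 < k)%N.
Local Notation is_sink_pos := (is_sink_pos k).
Local Notation next_source_pos := (next_source_pos k).
Implicit Types (f g : nat -> R) (t : seq R).

Definition linked_at f (r : nat) : bool :=
  if is_sink_pos r then f r.+1 <= f r <= f (r + k.+1)%N
  else 0 <= f r <= f (next_source_pos r).

(** Every value is compared with values at larger positions only, at most one on
    each side: integrating in order of position, no bound is a minimum. *)
Definition linked_chains (n : nat) f : Prop :=
  forall r, (0 < r <= n)%N -> linked_at f r.

Lemma linked_at_source f (l : nat) :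
  linked_at f (source_pos k l) =
  (0 <= f (source_pos k l) <= f (source_pos k l.+1)).
Proof. by rewrite /linked_at is_sink_pos_source // next_source_pos_source. Qed.

Lemma linked_at_sink f (j : nat) : (0 < j)%N ->
  linked_at f (sink_pos k j) =
  (f (source_pos k (k * j)) <= f (sink_pos k j) <= f (sink_pos k j.+1)).
Proof.
move=> j_gt0.
by rewrite /linked_at is_sink_pos_sink // succ_sink_pos // -sink_posS.
Qed.

Lemma linked_chainsS (n : nat) f :
  linked_chains n.+1 f <-> linked_at f n.+1 /\ linked_chains n f.
Proof.
split=> [linked|[linked_last linked] r /andP[r_gt0]].
  split=> [|r /andP[r_gt0 rn]]; first by apply: linked; rewrite leqnn.
  by apply: linked; rewrite r_gt0 leqW.
by rewrite leq_eqVlt => /predU1P[->//|rn]; apply: linked; rewrite r_gt0.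
Qed.

Lemma eq_linked_chains (n : nat) f g :
  (forall r, (r <= n.+1)%N -> f r = g r) ->
  (forall r, (n.+1 < r)%N -> is_sink_pos r != is_sink_pos n.+1 -> f r = g r) ->
  linked_chains n f <-> linked_chains n g.
Proof.
move=> fg_le fg_gt.
suff linkedE r : (r <= n)%N -> linked_at f r = linked_at g r.
  by split=> linked r r_in; have := linked r r_in; rewrite linkedE //;
    case/andP: r_in.
move=> rn; rewrite /linked_at [f r]fg_le ?leqW //.
have [r_sink|r_source] := boolP (is_sink_pos r).
  rewrite fg_le //; congr (_ <= _ <= _).
  have [/fg_le//|r_gt] := leqP (r + k.+1) n.+1; apply: fg_gt => //.
  rewrite is_sink_posD r_sink; apply/negP => /eqP n_sink.
  by move: r_gt; rewrite ltnNge is_sink_pos_gap // -n_sink.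
have [/fg_le->//|next_gt] := leqP (next_source_pos r) n.+1.
rewrite fg_gt // is_sink_pos_next_source //.
rewrite /next_source_pos in next_gt.
have rE : r = n by case: (is_sink_pos _) next_gt; lia.
by move: next_gt; rewrite rE; case: (is_sink_pos _); rewrite ?addn0 ?ltnn.
Qed.

(** [t] lists the values at positions [size t], ..., 1; beyond them every source
    position carries [s] and every sink position [z]. *)
Definition chain_value t (s z : R) (r : nat) : R :=
  nth (if is_sink_pos r then z else s) (0 :: rev t) r.

Lemma chain_value_gt t (s z : R) (r : nat) : (size t < r)%N ->
  chain_value t s z r = if is_sink_pos r then z else s.
Proof. by move=> tr; rewrite /chain_value nth_default //= size_rev. Qed.

Lemma chain_value_cons (x : R) t (s z : R) (r : nat) :
  chain_value (x :: t) s z r =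
  if r == (size t).+1 then x else chain_value t s z r.
Proof.
rewrite /chain_value rev_cons -rcons_cons nth_rcons /= size_rev.
by case: ltngtP => // tr; rewrite nth_default //= size_rev ltnW.
Qed.

Lemma eq_chain_value t (s s' z z' : R) (r : nat) :
  (r <= size t)%N -> chain_value t s z r = chain_value t s' z' r.
Proof. by move=> rt; apply: set_nth_default; rewrite /= size_rev. Qed.

Lemma chain_value_tnth (n : nat) (t : n.-tuple R) (s z : R) (i : 'I_n) :
  chain_value t s z (n - i) = tnth t i.
Proof.
have i_lt := ltn_ord i.
rewrite /chain_value -[(n - i)%N]prednK ?subn_gt0 //=.
rewrite nth_rev size_tuple; last by lia.
rewrite (tnth_nth (if is_sink_pos (n - i) then z else s)); congr (nth _ _ _).
  by rewrite prednK ?subn_gt0.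
by lia.
Qed.

Lemma linked_chains_cons (x : R) t (s z : R) : let n := size t in
  linked_chains n (chain_value (x :: t) s z) <->
  linked_chains n (if is_sink_pos n.+1 then chain_value t s x
                   else chain_value t x z).
Proof.
move=> n; apply: eq_linked_chains => r.
  rewrite chain_value_cons; case: eqP => [->|/eqP r_neq] r_le.
    by case: ifP => n_sink; rewrite chain_value_gt // n_sink.
  have rn : (r <= n)%N by rewrite -ltnS ltn_neqAle r_neq.
  by case: ifP => _; exact: eq_chain_value.
move=> nr; rewrite chain_value_cons gtn_eqF // chain_value_gt ?(ltnW nr) //.
by case: (boolP (is_sink_pos n.+1)) => _;
  rewrite chain_value_gt ?(ltnW nr) //; case: (is_sink_pos r).
Qed.

Lemma linked_at_cons_source (x : R) t (s z : R) : ~~ is_sink_pos (size t).+1 ->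
  linked_at (chain_value (x :: t) s z) (size t).+1 = (0 <= x <= s).
Proof.
move=> /negbTE t_source; rewrite /linked_at t_source !chain_value_cons eqxx.
rewrite gtn_eqF ?ltn_next_source_pos // chain_value_gt.
  by rewrite is_sink_pos_next_source.
exact/ltnW/ltn_next_source_pos.
Qed.

Lemma linked_at_cons_sink (x : R) t (s z : R) : is_sink_pos (size t).+1 ->
  linked_at (chain_value (x :: t) s z) (size t).+1 = (s <= x <= z).
Proof.
move=> t_sink; have gap_gt : ((size t).+1 < (size t).+1 + k.+1)%N.
  by rewrite -addSnnS leq_addr.
rewrite /linked_at t_sink !chain_value_cons eqxx !gtn_eqF //.
rewrite !chain_value_gt ?(ltnW gap_gt) //.
by rewrite is_sink_posS // is_sink_posD t_sink.
Qed.

Lemma lebesgue_linked_chains (n : nat) (s z : R) : 0 <= s -> s <= z ->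
  lebesgue_tuple [set t : n.-tuple R | linked_chains n (chain_value t s z)] =
  (ballot_poly k (source_rank k n) (sink_rank k n) s z)%:E.
Proof.
rewrite /source_rank; elim: n s z => [|n IHn] s z s_ge0 sz.
  rewrite lebesgue_tuple0 => [|r /andP[]]; last by case: r.
  by rewrite /sink_rank divn_small // ballot_poly00.
have rank_le : (sink_rank k n <= n)%N.
  by rewrite -ltnS ltn_divLR // -{1}[n.+1]muln1 ltn_mul2l.
have sliceE (t : n.+1.-tuple R) : linked_chains n.+1 (chain_value t s z) =
    if is_sink_pos n.+1
    then s <= thead t <= z /\
      linked_chains n (chain_value [tuple of behead t] s (thead t))
    else 0 <= thead t <= s /\
      linked_chains n (chain_value [tuple of behead t] (thead t) z).
  apply/propext; case/tupleP: t => x t; rewrite theadE /= linked_chainsS.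
  have := linked_chains_cons x t s z; have := @linked_at_cons_source x t s z.
  have := @linked_at_cons_sink x t s z; rewrite /= size_tuple.
  by case: ifPn => _; [move=> -> // _ -> | move=> _ -> // ->].
under eq_set do rewrite sliceE.
have rankS : sink_rank k n.+1 = (is_sink_pos n.+1 + sink_rank k n)%N.
  by rewrite /sink_rank divnS.
rewrite rankS; case: (boolP (is_sink_pos n.+1)) => [n_sink|_].
  rewrite (lebesgue_tuple_slices
    (fun x => [set t : n.-tuple R | linked_chains n (chain_value t s x)])).
  rewrite add1n subSS -integral_ballot_poly_upper //.
    apply: eq_integral => x; rewrite inE /= in_itv /= => /andP[sx _].
    exact: IHn.
  have := divnK n_sink; rewrite -/(sink_rank k n.+1) rankS n_sink.
  by lia.
rewrite (lebesgue_tuple_slices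
  (fun x => [set t : n.-tuple R | linked_chains n (chain_value t x z)])).
rewrite add0n subSn // -integral_ballot_poly_lower //.
apply: eq_integral => x; rewrite inE /= in_itv /= => /andP[x_ge0 xs].
by apply: IHn => //; exact: le_trans xs sz.
Qed.

End LinkedChains.

Section FlowPolytope.
Variables (n : nat) (G : multidigraph n).

Section Conservation.
Variable V : zmodType.
Implicit Type u : edge G -> V.

Definition excess u (v : 'I_n.+1) : V :=
  \sum_(e | src e == v) u e - \sum_(e | tgt e == v) u e.

Definition conservative u : Prop :=
  forall v : 'I_n.+1, (v < n)%N -> excess u v = 0.

Lemma excessD u u' (v : 'I_n.+1) :
  excess (fun e => u e + u' e) v = excess u v + excess u' v.
Proof. by rewrite /excess !big_split /= opprD addrACA. Qed.

Lemma excessN u (v : 'I_n.+1) : excess (fun e => - u e) v = - excess u v.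
Proof. by rewrite /excess !sumrN -opprD. Qed.

End Conservation.

Section Scalars.
Variable K : numDomainType.

Lemma excessZ (c : K) (u : edge G -> K) (v : 'I_n.+1) :
  excess (fun e => c * u e) v = c * excess u v.
Proof. by rewrite /excess -!mulr_sumr mulrBr. Qed.

Lemma excess_lincomb (m : nat) (w : 'I_m -> K) (y : 'I_m -> edge G -> K)
    (v : 'I_n.+1) :
  excess (fun e => \sum_i w i * y i e) v = \sum_i w i * excess (y i) v.
Proof.
have sumE (Q : pred (edge G)) :
    \sum_(e | Q e) \sum_i w i * y i e = \sum_i w i * \sum_(e | Q e) y i e.
  by rewrite exchange_big; apply: eq_bigr => i _; rewrite mulr_sumr.
by rewrite /excess !sumE -sumrB; apply: eq_bigr => i _; rewrite mulrBr.
Qed.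

Lemma excess_intr (z : edge G -> int) (v : 'I_n.+1) :
  excess (fun e => (z e)%:~R : K) v = (excess z v)%:~R.
Proof.
by rewrite /excess -!(raddf_sum (intr : {additive int -> K})) -intrB.
Qed.

Lemma conservative_intr (z : edge G -> int) :
  conservative (fun e => (z e)%:~R : K) <-> conservative z.
Proof.
split=> z_cons v vn; have := z_cons v vn; rewrite excess_intr; last by move->.
by move=> /eqP; rewrite intr_eq0 => /eqP.
Qed.

End Scalars.

Variables (R : realType) (netflow : 'I_n.+1 -> R).
Local Notation P := (flow_polytope (G := G) netflow).
Implicit Types (u x : edge G -> R).

Lemma affine_hull_excess x (v : 'I_n.+1) :
  affine_hull P x -> (v < n)%N -> excess x v = netflow v.
Proof.
move=> [m [w [y [Py w1 xE]]]] vn.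
rewrite (_ : x = fun e => \sum_i w i * y i e); last exact/funext.
rewrite excess_lincomb -[RHS]mul1r -w1 mulr_suml; apply: eq_bigr => i _.
by congr (_ * _); exact: (Py i).2.
Qed.

Section PositiveFlow.
Variable p : edge G -> R.
Hypotheses (Pp : P p) (p_gt0 : forall e, 0 < p e).

(** For [M] large, [p + u / M] is still nonnegative, and [p + u] lies on the
    line through it and [p]. *)
Lemma affine_hull_positive_flowD u :
  conservative u -> affine_hull P (fun e => p e + u e).
Proof.
move=> u_cons; pose M : R := 1 + \sum_e `|u e| / p e.
have sum_ge0 : 0 <= \sum_e `|u e| / p e.
  by apply: sumr_ge0 => e _; rewrite divr_ge0 // ltW.
have M_gt0 : 0 < M by rewrite ltr_pwDl.
have u_le e : `|u e| <= M * p e.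
  rewrite -ler_pdivrMr // /M (bigD1 e) //= addrCA lerDl addr_ge0 //.
  by apply: sumr_ge0 => e' _; rewrite divr_ge0 // ltW.
have Pq : P (fun e => p e + M^-1 * u e).
  split=> [e|v vn].
    rewrite -(pmulr_rge0 _ M_gt0) mulrDr mulVKf ?gt_eqF //.
    by have := u_le e; rewrite ler_norml => /andP[]; lra.
  rewrite -[LHS]/(excess _ v) excessD excessZ u_cons // mulr0 addr0.
  exact: Pp.2.
exists 2%N, (fun i => if i == ord0 then 1 - M else M).
exists (fun i => if i == ord0 then p else fun e => p e + M^-1 * u e).
split=> [i||e]; first by case: ifP.
  by rewrite !big_ord_recl big_ord0 /= addr0 subrK.
rewrite !big_ord_recl big_ord0 /= addr0 mulrDr mulVKf ?gt_eqF //.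
by rewrite mulrBl mul1r addrA subrK.
Qed.

Lemma affine_hull_flow_polytope x :
  affine_hull P x <-> forall v : 'I_n.+1, (v < n)%N -> excess x v = netflow v.
Proof.
split=> [Px v|xE]; first exact: affine_hull_excess.
rewrite (_ : x = fun e => p e + (x e - p e)); last first.
  by apply/funext => e; rewrite addrC subrK.
apply: affine_hull_positive_flowD => v vn.
by rewrite excessD excessN xE // -(Pp.2 v vn) subrr.
Qed.

Lemma direction_flow_polytope u : direction P u <-> conservative u.
Proof.
split=> [[x [y [Px Py uE]]] v vn|u_cons].
  rewrite (_ : u = fun e => x e - y e); last exact/funext.
  by rewrite excessD excessN !affine_hull_excess // subrr.
exists (fun e => p e + u e), p; split=> [||e].
- exact: affine_hull_positive_flowD.
- by apply/affine_hull_flow_polytope => v; exact: Pp.2.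
- by rewrite addrC addKr.
Qed.

End PositiveFlow.
End FlowPolytope.

Section CaracolFlows.
Variables (k a : nat).
Hypothesis k_gt0 : (0 < k)%N.
Local Notation edges := (mcar_edge k a.+1).

(** Vertices are counted backwards from [a + 1]: [source_edge l] joins 0 to the
    [l %/ k]-th of them, [sink_edge j] the [j]-th one to the sink, and
    [step_edge q] enters the block of the last [q] inner vertices.  The edge
    [(a + 1, a + 2)] is a [sink_edge] and not a [step_edge]. *)
Definition source_edge (l : nat) : edges :=
  inr (inord (a - l %/ k), Ordinal (ltn_pmod l k_gt0)).

Definition sink_edge (j : nat) : edges :=
  if insub (a - j)%N is Some i then inl (inr i) else inl (inl ord_max).

Definition step_edge (q : nat) : edges := inl (inl (inord (a - q))).

Definition inner_vertex (q : nat) : 'I_a.+3 := inord (a - q).+1.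

Lemma source_edgeE (i : 'I_a.+1) (m : 'I_k) :
  inr (i, m) = source_edge (k * (a - i) + m).
Proof.
have ia : (i <= a)%N by rewrite -ltnS.
rewrite /source_edge [(k * _)%N]mulnC divnMDl // divn_small // addn0 subKn //.
rewrite inord_val; congr (inr (_, _)); apply/val_inj => /=.
by rewrite modnMDl modn_small.
Qed.

Lemma source_index_lt (i : 'I_a.+1) (m : 'I_k) : (k * (a - i) + m < k * a.+1)%N.
Proof. by rewrite mulnS addnC -addSn leq_add // leq_mul2l leq_subr orbT. Qed.

Lemma sink_edge0 : sink_edge 0 = inl (inl ord_max).
Proof. by rewrite /sink_edge subn0 insubF // ltnn. Qed.

Lemma sink_edgeE (i : 'I_a) : inl (inr i) = sink_edge (a - i).
Proof.
have ia := ltn_ord i.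
rewrite /sink_edge subKn; last exact: ltnW.
by rewrite valK.
Qed.

Lemma step_edgeE (i : 'I_a.+1) : inl (inl i) = step_edge (a - i).
Proof. by rewrite /step_edge subKn ?inord_val // -ltnS. Qed.

Variant edge_spec : edges -> Prop :=
  | SourceEdge l of (l < k * a.+1)%N : edge_spec (source_edge l)
  | SinkEdge j of (j < a.+1)%N : edge_spec (sink_edge j)
  | StepEdge q of (0 < q <= a)%N : edge_spec (step_edge q).

Lemma edgeP (e : edges) : edge_spec e.
Proof.
case: e => [[i|i]|[i m]].
- have [ia|ai] := ltnP i a.
    by rewrite step_edgeE; constructor; rewrite subn_gt0 ia leq_subr.
  have -> : i = ord_max by apply/val_inj/eqP; rewrite eqn_leq ai -ltnS ltn_ord.
  by rewrite -sink_edge0; constructor.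
- by rewrite sink_edgeE; constructor; rewrite ltnS leq_subr.
- by rewrite source_edgeE; constructor; exact: source_index_lt.
Qed.

Lemma inner_vertexP (v : 'I_a.+3) : (v < a.+2)%N ->
  v = ord0 \/ exists2 q, (q <= a)%N & v = inner_vertex q.
Proof.
move=> va; have [->|v_neq0] := eqVneq v ord0; [by left|right].
have v_gt0 : (0 < v)%N by rewrite lt0n.
exists (a.+1 - v)%N; first by lia.
by apply/val_inj; rewrite /= inordK; lia.
Qed.

Lemma inner_vertex_lt (q : nat) : (inner_vertex q < a.+2)%N.
Proof. by rewrite /= inordK !ltnS ?leqW // leq_subr. Qed.

Section Potentials.
Variable V : zmodType.
Implicit Types (S Z : nat -> V) (u : edges -> V).
Local Notation excess := (excess (G := MCar k a.+1)).
Local Notation conservative := (conservative (G := MCar k a.+1)).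

(** The flow with [S l] on the last [l] edges out of 0 and [Z j] on the last [j]
    edges into the sink. *)
Definition flow_of_sums S Z (e : edges) : V :=
  match e with
  | inl (inl i) =>
      if (i == a :> nat) then Z 1%N - Z 0%N else Z (a - i)%N - S (k * (a - i))%N
  | inl (inr i) => Z (a - i).+1 - Z (a - i)%N
  | inr (i, m) => S (k * (a - i) + m).+1 - S (k * (a - i) + m)%N
  end.

Definition source_sum u (l : nat) : V := \sum_(0 <= l' < l) u (source_edge l').
Definition sink_sum u (j : nat) : V := \sum_(0 <= j' < j) u (sink_edge j').

Lemma flow_of_sums_source S Z (l : nat) : (l < k * a.+1)%N ->
  flow_of_sums S Z (source_edge l) = S l.+1 - S l.
Proof.
move=> l_lt; have lk : (l %/ k <= a)%N by rewrite -ltnS ltn_divLR // mulnC.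
by rewrite /= inordK ?ltnS ?leq_subr // subKn // mulnC -divn_eq.
Qed.

Lemma flow_of_sums_sink S Z (j : nat) : (j < a.+1)%N ->
  flow_of_sums S Z (sink_edge j) = Z j.+1 - Z j.
Proof.
case: j => [|j] ja; first by rewrite sink_edge0 /= eqxx.
have ja' : (a - j.+1 < a)%N by lia.
by rewrite /sink_edge insubT /= subKn.
Qed.

Lemma flow_of_sums_step S Z (q : nat) : (0 < q <= a)%N ->
  flow_of_sums S Z (step_edge q) = Z q - S (k * q)%N.
Proof.
move=> /andP[q_gt0 qa]; rewrite /= inordK ?ltnS ?leq_subr // subKn //.
by rewrite ltn_eqF // ltn_subrL q_gt0 (leq_trans q_gt0).
Qed.

Lemma flow_of_sums_forall S Z (Q : V -> Prop) :
  (forall e, Q (flow_of_sums S Z e)) <->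
  [/\ forall l, (l < k * a.+1)%N -> Q (S l.+1 - S l),
      forall j, (j < a.+1)%N -> Q (Z j.+1 - Z j) &
      forall q, (0 < q <= a)%N -> Q (Z q - S (k * q)%N)].
Proof.
split=> [Qe|[QS QZ QSZ] e].
  split=> [l l_lt|j j_lt|q q_in].
  - by rewrite -(flow_of_sums_source S Z).
  - by rewrite -(flow_of_sums_sink S).
  - by rewrite -flow_of_sums_step.
case: (edgeP e) => [l l_lt|j j_lt|q q_in].
- by rewrite flow_of_sums_source //; exact: QS.
- by rewrite flow_of_sums_sink //; exact: QZ.
- by rewrite flow_of_sums_step //; exact: QSZ.
Qed.

Lemma eq_flow_of_sums S S' Z Z' :
  (forall l, (l <= k * a.+1)%N -> S l = S' l) ->
  (forall j, (j <= a.+1)%N -> Z j = Z' j) ->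
  flow_of_sums S Z = flow_of_sums S' Z'.
Proof.
move=> SE ZE; apply/funext => e; case: (edgeP e) => [l l_lt|j j_lt|q].
- by rewrite !flow_of_sums_source // !SE // ltnW.
- by rewrite !flow_of_sums_sink // !ZE // ltnW.
- move=> /[dup] /andP[_ qa] q_in; rewrite !flow_of_sums_step // ZE ?SE ?leqW //.
  by rewrite leq_mul2l leqW ?orbT.
Qed.

Lemma source_sum_flow_of_sums S Z (l : nat) : (l <= k * a.+1)%N ->
  source_sum (flow_of_sums S Z) l = S l - S 0%N.
Proof.
move=> l_le; rewrite -telescope_sumr // /source_sum !big_nat.
apply: eq_bigr => l' /andP[_ l'l]; rewrite flow_of_sums_source //.
exact: leq_trans l_le.
Qed.

Lemma sink_sum_flow_of_sums S Z (j : nat) : (j <= a.+1)%N ->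
  sink_sum (flow_of_sums S Z) j = Z j - Z 0%N.
Proof.
move=> j_le; rewrite -telescope_sumr // /sink_sum !big_nat.
apply: eq_bigr => j' /andP[_ j'j]; rewrite flow_of_sums_sink //.
exact: leq_trans j_le.
Qed.

Definition step_flow u (q : nat) : V :=
  if (0 < q <= a)%N then u (step_edge q) else 0.

(** The inflow minus the outflow of the block of the last [q] inner vertices. *)
Definition block_excess u (q : nat) : V :=
  step_flow u q + source_sum u (k * q) - sink_sum u q.

Lemma source_sum_block u (q : nat) :
  source_sum u (k * q.+1) =
  source_sum u (k * q) + \sum_(m < k) u (source_edge (k * q + m)).
Proof.
rewrite /source_sum mulnSr (big_cat_nat (leq0n _) (leq_addr _ _)) /=.
congr (_ + _); rewrite -{1}[(k * q)%N]add0n big_addn addKn big_mkord.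
by apply: eq_bigr => m _; rewrite addnC.
Qed.

Lemma source_sum_blocks u (q : nat) :
  source_sum u (k * q) =
  \sum_(q' < q) \sum_(m < k) u (source_edge (k * q' + m)).
Proof.
elim: q => [|q IHq]; first by rewrite muln0 big_ord0 /source_sum big_geq.
by rewrite source_sum_block IHq big_ord_recr.
Qed.

Lemma inord_eq_inner_vertex (i q : nat) : (i <= a.+1)%N ->
  (inord i.+1 == inner_vertex q) = (i == a - q)%N.
Proof. by move=> ia; rewrite -val_eqE /= !inordK // !ltnS leqW // leq_subr. Qed.

Lemma ord_eq_inord_sub (i : 'I_a.+1) (q : nat) :
  (i == a - q :> nat)%N = (i == inord (a - q)).
Proof. by rewrite -val_eqE /= inordK // ltnS leq_subr. Qed.

Lemma sum_source_edges u (Q : pred 'I_a.+1) :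
  \sum_(p : 'I_a.+1 * 'I_k | Q p.1) u (inr p) =
  \sum_(i | Q i) \sum_(m < k) u (inr (i, m)).
Proof.
by rewrite (pair_big Q predT); apply: eq_big => -[i m] //=; rewrite andbT.
Qed.

Lemma outflow_inner u (q : nat) : (q <= a)%N ->
  \sum_(e : edges | mcar_src e == inner_vertex q) u e =
  step_flow u q + u (sink_edge q).
Proof.
move=> qa; rewrite !big_sumType /= [X in _ + _ + X]big_pred0 ?addr0; last first.
  by move=> p; rewrite -val_eqE /= inordK // !ltnS leqW // leq_subr.
rewrite (eq_bigl (pred1 (inord (a - q)))) => [|i]; last first.
  by rewrite inord_eq_inner_vertex ?ord_eq_inord_sub // ltnW.
rewrite big_pred1_eq -/(step_edge q) /step_flow qa andbT.
have src_sinkE (i : 'I_a) :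
    (inord i.+1 == inner_vertex q) = (i == a - q :> nat)%N.
  by rewrite inord_eq_inner_vertex // leqW // ltnW.
have [q0|q_gt0] := posnP q.
  rewrite big_pred0 => [|i]; last by rewrite src_sinkE q0 subn0 ltn_eqF.
  rewrite q0 addr0 add0r sink_edge0; congr (u (inl (inl _))).
  by apply/val_inj; rewrite /= inordK subn0.
have qa' : (a - q < a)%N by rewrite ltn_subrL q_gt0 (leq_trans q_gt0).
rewrite (eq_bigl (pred1 (Ordinal qa'))) => [|i]; last by rewrite src_sinkE.
by rewrite big_pred1_eq sink_edgeE /= subKn.
Qed.

Lemma inflow_inner u (q : nat) : (q <= a)%N ->
  \sum_(e : edges | mcar_tgt e == inner_vertex q) u e =
  step_flow u q.+1 + \sum_(m < k) u (source_edge (k * q + m)).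
Proof.
move=> qa; rewrite !big_sumType /= [X in _ + X + _]big_pred0 ?addr0; last first.
  by move=> i; rewrite -val_eqE /= inordK ?gtn_eqF // !ltnS ?leqW // leq_subr.
congr (_ + _).
  rewrite /step_flow /=; case: ifPn => [q_lt|q_ge]; last first.
    by rewrite big_pred0 // => i; rewrite inord_eq_inner_vertex //; lia.
  rewrite (eq_bigl (pred1 (inord (a - q.+1)))) ?big_pred1_eq // => i.
  by rewrite inord_eq_inner_vertex //= -ord_eq_inord_sub; lia.
rewrite (eq_bigl (fun p => p.1 == inord (a - q))) => [|[i m]]; last first.
  by rewrite inord_eq_inner_vertex ?ord_eq_inord_sub // ltnW.
rewrite (sum_source_edges _ (pred1 (inord (a - q)))) big_pred1_eq.
apply: eq_bigr => m _; rewrite -[in RHS](subKn qa).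
by rewrite source_edgeE inordK ?subKn // ltnS leq_subr.
Qed.

Lemma excess_inner u (q : nat) : (q <= a)%N ->
  excess u (inner_vertex q) = block_excess u q - block_excess u q.+1.
Proof.
move=> qa; rewrite /(excess _ _) outflow_inner // inflow_inner //.
rewrite /block_excess source_sum_block /sink_sum big_nat_recr //=.
rewrite opprB addrA [_ - _ + (_ + _)]addrA subrK.
by rewrite [X in _ = X - _]addrAC [_ + (source_sum _ _ + _)]addrCA addrKA.
Qed.

Lemma excess_source u : excess u ord0 = source_sum u (k * a.+1).
Proof.
rewrite /(excess _ _) [X in _ - X]big_pred0 ?subr0; last first.
  move=> [[i|i]|[i m]] //=; have i_lt := ltn_ord i;
  by rewrite -val_eqE /= inordK //; lia.
rewrite big_sumType /= big_pred0 ?add0r; last first.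
  by case=> i; rewrite -val_eqE /= inordK //; have := ltn_ord i; lia.
rewrite source_sum_blocks (eq_bigl (fun p => predT p.1)) => [|[]//].
rewrite sum_source_edges.
rewrite (reindex_inj rev_ord_inj); apply: eq_bigr => i _; apply: eq_bigr => m _.
by rewrite source_edgeE /= subSS subKn // -ltnS.
Qed.

Lemma block_excess0 u : block_excess u 0 = 0.
Proof.
by rewrite /block_excess /source_sum /sink_sum muln0 !big_geq ?addr0 ?subr0.
Qed.

Lemma conservative_block_excess u (q : nat) :
  conservative u -> (q <= a.+1)%N -> block_excess u q = 0.
Proof.
move=> u_cons; elim: q => [|q IHq] q_le; first exact: block_excess0.
have := u_cons _ (inner_vertex_lt q).
rewrite excess_inner // (IHq (ltnW q_le)) sub0r => /eqP.
by rewrite oppr_eq0 => /eqP.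
Qed.

Lemma conservative_source_sum u :
  conservative u -> source_sum u (k * a.+1) = 0.
Proof. by move=> u_cons; rewrite -excess_source u_cons. Qed.

Lemma step_flowE u (q : nat) :
  block_excess u q = 0 -> step_flow u q = sink_sum u q - source_sum u (k * q).
Proof. by move=> /eqP; rewrite subr_eq0 -eq_sym => /eqP ->; rewrite addrK. Qed.

Lemma conservative_sink_sum u : conservative u -> sink_sum u a.+1 = 0.
Proof.
move=> u_cons; have := step_flowE (conservative_block_excess u_cons (leqnn _)).
by rewrite conservative_source_sum // subr0 /step_flow ltnn.
Qed.

Lemma flow_of_sumsK u :
  conservative u -> flow_of_sums (source_sum u) (sink_sum u) = u.
Proof.
move=> u_cons; apply/funext => e; case: (edgeP e) => [l l_lt|j j_lt|q q_in].
- rewrite flow_of_sums_source // /source_sum big_nat_recr //=.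
  by rewrite [_ + u _]addrC addrK.
- rewrite flow_of_sums_sink // /sink_sum big_nat_recr //=.
  by rewrite [_ + u _]addrC addrK.
- rewrite flow_of_sums_step // -step_flowE /step_flow ?q_in //.
  by apply: conservative_block_excess => //; case/andP: q_in => _ /leqW.
Qed.

Lemma block_excess_flow_of_sums S Z (q : nat) :
  S 0%N = 0 -> Z 0%N = 0 -> S (k * a.+1)%N = Z a.+1 -> (q <= a.+1)%N ->
  block_excess (flow_of_sums S Z) q = 0.
Proof.
move=> S0 Z0 total; case: q => [|q] q_le; first exact: block_excess0.
have kq_le : (k * q.+1 <= k * a.+1)%N by rewrite leq_mul2l q_le orbT.
rewrite /block_excess source_sum_flow_of_sums // sink_sum_flow_of_sums //.
rewrite S0 Z0 !subr0 /step_flow; case: ifPn => [q_in|q_notin].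
  by rewrite flow_of_sums_step // subrK subrr.
have -> : q = a by lia.
by rewrite total add0r subrr.
Qed.

Lemma excess_flow_of_sums S Z (v : 'I_a.+3) :
  S 0%N = 0 -> Z 0%N = 0 -> S (k * a.+1)%N = Z a.+1 -> (v < a.+2)%N ->
  excess (flow_of_sums S Z) v = if v == ord0 then Z a.+1 else 0.
Proof.
move=> S0 Z0 total /inner_vertexP[->|[q qa ->]].
  by rewrite excess_source source_sum_flow_of_sums // S0 subr0 total eqxx.
rewrite excess_inner // !block_excess_flow_of_sums // ?leqW // subrr ifN //.
by rewrite -val_eqE /= inordK // !ltnS leqW // leq_subr.
Qed.

End Potentials.
End CaracolFlows.

Section ChainCoordinates.
Variables (k a : nat).
Hypothesis k_gt0 : (0 < k)%N.
Local Notation edges := (mcar_edge k a.+1).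
Local Notation excess := (excess (G := MCar k a.+1)).
Local Notation conservative := (conservative (G := MCar k a.+1)).
Local Notation source_pos := (source_pos k).
Local Notation sink_pos := (sink_pos k).

Definition flow_dim : nat := (k * a.+1 + a - 1)%N.

Lemma source_pos_total : source_pos (k * a.+1) = flow_dim.+2.
Proof. by rewrite source_posM // /flow_dim mulSn; nia. Qed.

Lemma sink_pos_total : sink_pos a.+1 = flow_dim.+1.
Proof. by apply: succn_inj; rewrite succ_sink_pos // source_pos_total. Qed.

Lemma leq_sink_pos_dim (j : nat) : (sink_pos j <= flow_dim)%N = (j <= a)%N.
Proof. by rewrite -ltnS -sink_pos_total ltnNge leq_sink_pos // -ltnNge. Qed.

Lemma leq_source_pos_dim (l : nat) :
  (source_pos l <= flow_dim)%N = (l < k * a.+1)%N.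
Proof.
rewrite -(leqW_mono (leq_source_pos k)) source_pos_total ltnS [RHS]leq_eqVlt.
suff /negbTE -> : source_pos l != flow_dim.+1 by [].
apply/eqP => lE; have := is_sink_pos_source k_gt0 l.
by rewrite lE -sink_pos_total is_sink_pos_sink.
Qed.

Lemma sink_rank_dim : sink_rank k flow_dim = a.
Proof.
have -> : flow_dim = (a * k.+1 + k.-1)%N by rewrite /flow_dim; nia.
by rewrite /sink_rank -addnS prednK // divnMDl // divn_small // addn0.
Qed.

Lemma source_rank_dim : source_rank k flow_dim = (k * a.+1 - 1)%N.
Proof. by rewrite /source_rank sink_rank_dim /flow_dim; nia. Qed.

Definition chain_flow (V : zmodType) (f : nat -> V) : edges -> V :=
  flow_of_sums (f \o source_pos) (f \o sink_pos).

Lemma chain_flow_diff (e : edges) : exists r r' : nat,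
  forall (V : zmodType) (f : nat -> V), chain_flow f e = f r - f r'.
Proof.
case: (edgeP k_gt0 e) => [l l_lt|j j_lt|q q_in].
- exists (source_pos l.+1), (source_pos l) => V f; exact: flow_of_sums_source.
- exists (sink_pos j.+1), (sink_pos j) => V f; exact: flow_of_sums_sink.
- exists (sink_pos q), (source_pos (k * q)) => V f; exact: flow_of_sums_step.
Qed.

Section Flows.
Variable V : zmodType.
Implicit Types (f g : nat -> V) (u : edges -> V).

Lemma chain_flowD f g (e : edges) :
  chain_flow (fun r => f r + g r) e = chain_flow f e + chain_flow g e.
Proof.
by have [r [r' flowE]] := chain_flow_diff e; rewrite !flowE opprD addrACA.
Qed.

Lemma excess_chain_flow f (v : 'I_a.+3) :
  f 0%N = 0 -> f flow_dim.+2 = f flow_dim.+1 -> (v < a.+2)%N ->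
  excess (chain_flow f) v = if v == ord0 then f flow_dim.+1 else 0.
Proof.
move=> f0 total va; rewrite /chain_flow (excess_flow_of_sums k_gt0) //=.
- by rewrite sink_pos_total.
- by rewrite source_pos0.
- by rewrite sink_pos0.
- by rewrite source_pos_total sink_pos_total.
Qed.

Definition chain_potential u (r : nat) : V :=
  if is_sink_pos k r then sink_sum u (sink_rank k r)
  else source_sum k_gt0 u (source_rank k r).

Lemma chain_potential0 u : chain_potential u 0 = 0.
Proof.
rewrite /chain_potential /is_sink_pos gtnNdvd //.
by rewrite /source_rank /source_sum big_geq.
Qed.

Lemma chain_potentialK u : conservative u ->
  chain_flow
    (fun r => if (r <= flow_dim)%N then chain_potential u r else 0) = u.
Proof.
move=> u_cons; rewrite -[RHS](flow_of_sumsK k_gt0 u_cons).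
apply: eq_flow_of_sums => //= [l l_le|[|j] j_le].
- rewrite leq_source_pos_dim /chain_potential is_sink_pos_source //.
  rewrite source_posK //; case: ifPn => //; rewrite -leqNgt => l_ge.
  have -> : l = (k * a.+1)%N by apply/eqP; rewrite eqn_leq l_le.
  by rewrite conservative_source_sum.
- by rewrite sink_pos0 leq0n chain_potential0 /sink_sum big_geq.
- rewrite leq_sink_pos_dim /chain_potential is_sink_pos_sink // sink_posK //.
  case: ifPn => //; rewrite -ltnNge => j_ge.
  have -> : j.+1 = a.+1 by apply/eqP; rewrite eqn_leq j_le.
  by rewrite (conservative_sink_sum k_gt0).
Qed.

Lemma chain_flow_eq0 f (r : nat) :
  f 0%N = 0 -> chain_flow f = (fun=> 0) -> (0 < r <= flow_dim)%N -> f r = 0.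
Proof.
move=> f0 flow0 /andP[/(positionP k_gt0)[l _|j _]].
  rewrite leq_source_pos_dim => /ltnW l_le.
  have := source_sum_flow_of_sums k_gt0 (f \o source_pos) (f \o sink_pos) l_le.
  by rewrite -/(chain_flow f) flow0 /= source_pos0 f0 subr0 /source_sum big1.
rewrite leq_sink_pos_dim => /leqW j_le.
have := sink_sum_flow_of_sums k_gt0 (f \o source_pos) (f \o sink_pos) j_le.
by rewrite -/(chain_flow f) flow0 /= sink_pos0 f0 subr0 /sink_sum big1.
Qed.

End Flows.

Definition basis_flow (i : 'I_flow_dim) : edges -> int :=
  chain_flow (fun r => (r == flow_dim - i)%N%:R).

Section Coordinates.
Variable V : nzRingType.
Implicit Types (c : 'I_flow_dim -> V).

Definition coord_value c (r : nat) : V :=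
  \sum_i c i * (r == flow_dim - i)%N%:R.

Lemma sum_basis_flow c (e : edges) :
  \sum_i c i * (basis_flow i e)%:~R = chain_flow (coord_value c) e.
Proof.
have [r [r' flowE]] := chain_flow_diff e.
rewrite flowE /coord_value -sumrB; apply: eq_bigr => i _.
by rewrite /basis_flow flowE intrB !mulrz_nat mulrBr.
Qed.

Lemma coord_value_ord c (i : 'I_flow_dim) : coord_value c (flow_dim - i) = c i.
Proof.
rewrite /coord_value (bigD1 i) //= eqxx mulr1 big1 ?addr0 // => i' i'i.
suff /negbTE -> : (flow_dim - i != flow_dim - i')%N by rewrite mulr0.
apply: contra i'i; rewrite -val_eqE /= => /eqP.
by have := ltn_ord i; have := ltn_ord i'; lia.
Qed.

Lemma coord_value_out c (r : nat) :
  (r == 0)%N || (flow_dim < r)%N -> coord_value c r = 0.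
Proof.
move=> r_out; rewrite /coord_value big1 // => i _.
suff /negbTE -> : (r != flow_dim - i)%N by rewrite mulr0.
by have := ltn_ord i; lia.
Qed.

Lemma coord_valueK (T : nat -> V) (r : nat) : T 0%N = 0 ->
  coord_value (fun i => T (flow_dim - i)%N) r =
  if (r <= flow_dim)%N then T r else 0.
Proof.
move=> T0; have [->|r_gt0] := posnP r; first by rewrite coord_value_out // T0.
case: leqP => [r_le|r_gt]; last by rewrite coord_value_out // r_gt orbT.
have i_lt : (flow_dim - r < flow_dim)%N by lia.
have rE : (flow_dim - Ordinal i_lt = r)%N by rewrite /= subKn.
by rewrite -{1}rE coord_value_ord rE.
Qed.

Lemma conservative_coordinates (u : edges -> V) : conservative u ->
  exists c, forall e, u e = \sum_i c i * (basis_flow i e)%:~R.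
Proof.
move=> u_cons; exists (fun i => chain_potential u (flow_dim - i)) => e.
rewrite sum_basis_flow -[in LHS](chain_potentialK u_cons).
congr (chain_flow _ e).
by apply/funext => r; rewrite coord_valueK // chain_potential0.
Qed.

Lemma basis_flow_free c :
  (forall e, \sum_i c i * (basis_flow i e)%:~R = 0) -> forall i, c i = 0.
Proof.
move=> c_rel i; rewrite -coord_value_ord; apply: chain_flow_eq0.
- by rewrite coord_value_out.
- by apply/funext => e; rewrite -sum_basis_flow c_rel.
- by rewrite subn_gt0 ltn_ord leq_subr.
Qed.

End Coordinates.

Lemma basis_flow_conservative (i : 'I_flow_dim) : conservative (basis_flow i).
Proof.
move=> v va; rewrite excess_chain_flow //; have i_lt := ltn_ord i.
- by case: ifP => // _; rewrite gtn_eqF // ltnS leq_subr.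
- by rewrite eq_sym gtn_eqF // subn_gt0.
- by rewrite !gtn_eqF // !ltnS ?leqW // leq_subr.
Qed.

End ChainCoordinates.

Section UnitFlows.
Variables (R : realType) (k a : nat).
Hypothesis k_gt0 : (0 < k)%N.
Local Notation source_pos := (source_pos k).
Local Notation sink_pos := (sink_pos k).
Local Notation flow_dim := (flow_dim k a).
Local Notation P :=
  (flow_polytope (G := MCar k a.+1) (unit_netflow R (n := a.+1))).

Lemma flow_polytope_flow_of_sums (S Z : nat -> R) :
  S 0%N = 0 -> Z 0%N = 0 -> S (k * a.+1)%N = 1 -> Z a.+1 = 1 ->
  P (@flow_of_sums k a R S Z) <-> forall e, 0 <= @flow_of_sums k a R S Z e.
Proof.
move=> S0 Z0 S1 Z1; split=> [[]//|flow_ge0]; split=> // v va.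
rewrite -[LHS]/(excess (G := MCar k a.+1) _ v) excess_flow_of_sums ?S1 ?Z1 //.
rewrite /unit_netflow; case: ifP => // _.
by rewrite ifN // -val_eqE /= ltn_eqF.
Qed.

(** Squaring pushes the partial sums [S_(k j)] strictly below [Z_j]. *)
Lemma exists_positive_unit_flow : exists2 p, P p & forall e, 0 < p e.
Proof.
pose N := (k * a.+1)%N; pose S l : R := (l%:R / N%:R) ^+ 2.
pose Z j : R := j%:R / a.+1%:R.
have N_gt0 : 0 < N%:R :> R by rewrite ltr0n muln_gt0 k_gt0.
have p_gt0 e : 0 < @flow_of_sums k a R S Z e.
  apply: (iffRL (flow_of_sums_forall a k_gt0 S Z (fun x => 0 < x))) e.
  split=> [l _|j _|q /andP[q_gt0 qa]]; rewrite subr_gt0.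
  - rewrite ltr_pXn2r ?nnegrE ?divr_ge0 ?ler0n //.
    by rewrite ltr_pM2r ?invr_gt0 // ltr_nat.
  - by rewrite ltr_pM2r ?invr_gt0 ?ltr0n // ltr_nat.
  - have Zq_gt0 : 0 < Z q by rewrite divr_gt0 ?ltr0n.
    have Zq_lt1 : Z q < 1 by rewrite ltr_pdivrMr ?ltr0n // mul1r ltr_nat.
    have -> : S (k * q)%N = Z q ^+ 2.
      by rewrite /S /Z /N !natrM -mulf_div divff ?mul1r // pnatr_eq0 -lt0n.
    by rewrite expr2 gtr_pMl.
exists (@flow_of_sums k a R S Z) => //.
apply/flow_polytope_flow_of_sums; rewrite /S /Z ?mul0r ?expr0n //.
- by rewrite divff ?expr1n // gt_eqF.
- by rewrite divff // pnatr_eq0.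
- by move=> e; apply: ltW.
Qed.

Lemma unit_flow_lattice_basis : lattice_basis P (@basis_flow k a).
Proof.
have [p Pp p_gt0] := exists_positive_unit_flow.
have dirP := direction_flow_polytope Pp p_gt0; split.
- by move=> i; apply/dirP/conservative_intr/basis_flow_conservative.
- move=> z /dirP/conservative_intr z_cons.
  have [c zE] := conservative_coordinates k_gt0 z_cons; exists c => e.
  by rewrite zE; apply: eq_bigr => i _; rewrite intz.
- move=> c c_rel; apply: (basis_flow_free k_gt0) => e; rewrite -[RHS](c_rel e).
  by apply: eq_bigr => i _; rewrite intz.
- by move=> u /dirP; exact: conservative_coordinates.
Qed.

Definition base_flow : mcar_edge k a.+1 -> R :=
  chain_flow (fun r => (flow_dim < r)%N%:R).

Lemma base_flow_affine_hull : affine_hull P base_flow.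
Proof.
have [p Pp p_gt0] := exists_positive_unit_flow.
apply/(affine_hull_flow_polytope Pp p_gt0) => v va.
rewrite excess_chain_flow ?ltnSn ?ltnS ?leqnSn // /unit_netflow.
by case: ifP => // _; rewrite ifN // -val_eqE /= ltn_eqF.
Qed.

Lemma base_flow_coordinates (t : flow_dim.-tuple R) (e : mcar_edge k a.+1) :
  base_flow e + \sum_i tnth t i * (basis_flow i e)%:~R =
  chain_flow (chain_value k t 1 1) e.
Proof.
rewrite sum_basis_flow // -chain_flowD //; congr (chain_flow _ e).
apply/funext => r; have [r_le|r_gt] := leqP r flow_dim; last first.
  rewrite coord_value_out ?r_gt ?orbT // addr0.
  by rewrite chain_value_gt ?size_tuple // if_same.
rewrite add0r; pose T := chain_value k t 1 1.
have -> : tnth t = fun i => T (flow_dim - i)%N.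
  by apply/funext => i; rewrite /T chain_value_tnth.
by rewrite coord_valueK // r_le.
Qed.

Lemma linked_chainsP (f : nat -> R) :
  linked_chains k flow_dim f <->
  (forall l, (0 < l < k * a.+1)%N ->
     0 <= f (source_pos l) <= f (source_pos l.+1)) /\
  (forall j, (0 < j <= a)%N ->
     f (source_pos (k * j)) <= f (sink_pos j) <= f (sink_pos j.+1)).
Proof.
split=> [linked|[linkedS linkedZ] r /andP[/(positionP k_gt0)[l l_gt0|j j_gt0]]].
- split=> [l /andP[l_gt0 l_lt]|j /andP[j_gt0 j_le]].
    rewrite -linked_at_source //; apply: linked.
    rewrite leq_source_pos_dim // l_lt andbT.
    by rewrite -(source_pos0 k) (leqW_mono (leq_source_pos k)).
  rewrite -linked_at_sink //; apply: linked.
  rewrite leq_sink_pos_dim // j_le andbT.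
  by rewrite -(ltn_predK j_gt0) /sink_pos mulnS; lia.
- rewrite leq_source_pos_dim // linked_at_source // => l_lt.
  by rewrite linkedS ?l_gt0.
- rewrite leq_sink_pos_dim // linked_at_sink // => j_le.
  by rewrite linkedZ ?j_gt0.
Qed.

Lemma flow_polytope_chain_flow (f : nat -> R) :
  f 0%N = 0 -> f flow_dim.+1 = 1 -> f flow_dim.+2 = 1 ->
  P (chain_flow f) <-> linked_chains k flow_dim f.
Proof.
pose S := f \o source_pos; pose Z := f \o sink_pos => f0 fZ1 fS1.
have S0 : S 0%N = 0 by rewrite /S /= source_pos0.
have Z0 : Z 0%N = 0 by rewrite /Z /= sink_pos0.
have S1 : S (k * a.+1)%N = 1 by rewrite /S /= source_pos_total.
have Z1 : Z a.+1 = 1 by rewrite /Z /= sink_pos_total.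
rewrite flow_polytope_flow_of_sums //.
rewrite (flow_of_sums_forall a k_gt0 S Z (fun x => 0 <= x)) linked_chainsP.
split=> [[S_le Z_le SZ_le]|[S_linked Z_linked]].
  have S_ge0 l : (l <= k * a.+1)%N -> 0 <= S l.
    elim: l => [|l IHl] l_le; first by rewrite S0.
    by apply: le_trans (IHl (ltnW l_le)) _; rewrite -subr_ge0; exact: S_le.
  split=> [l /andP[_ l_lt]|j j_in].
    by apply/andP; split; [exact/S_ge0/ltnW | rewrite -subr_ge0; exact: S_le].
  apply/andP; split; rewrite -subr_ge0; first exact: SZ_le.
  by apply: Z_le; case/andP: j_in.
have S_ge0 l : (0 < l <= k * a.+1)%N -> 0 <= S l.
  move=> /andP[l_gt0]; rewrite leq_eqVlt => /predU1P[->|l_lt].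
    by rewrite S1.
  by have /andP[] := S_linked l (introT andP (conj l_gt0 l_lt)).
split=> [l l_lt|j j_lt|q q_in]; rewrite subr_ge0.
- have [->|l_gt0] := posnP l; first by rewrite S0 S_ge0 // muln_gt0 k_gt0.
  by have /andP[] := S_linked l (introT andP (conj l_gt0 l_lt)).
- have [->|j_gt0] := posnP j; last first.
    by have /andP[] := Z_linked j (introT andP (conj j_gt0 j_lt)).
  rewrite Z0; have [a0|a_gt0] := posnP a; first by rewrite -[1%N]/(0.+1) -a0 Z1.
  have /andP[SZ_le _] := Z_linked 1%N (introT andP (conj isT a_gt0)).
  apply: le_trans SZ_le; apply: S_ge0; rewrite muln1 k_gt0.
  by rewrite leq_pmulr.
- by have /andP[] := Z_linked q q_in.
Qed.

Lemma flow_polytope_linked_chains :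
  [set t : flow_dim.-tuple R | P (fun e => base_flow e +
     \sum_i tnth t i * (basis_flow i e)%:~R)] =
  [set t : flow_dim.-tuple R | linked_chains k flow_dim (chain_value k t 1 1)].
Proof.
have linkedP (t : flow_dim.-tuple R) :
    P (chain_flow (chain_value k t 1 1)) <->
    linked_chains k flow_dim (chain_value k t 1 1).
  apply: flow_polytope_chain_flow;
    by rewrite // chain_value_gt ?size_tuple ?if_same.
by apply/seteqP; split=> t /=; under eq_fun do rewrite base_flow_coordinates //;
  move/linkedP.
Qed.

End UnitFlows.

Theorem theorem5p3 (R : realType) (k a : nat) (hk : (1 <= k)%N) (ha : (1 <= a)%N) :
  has_normalized_volume
    (flow_polytope (G := MCar k a) (unit_netflow R (n := a)))
    (Cat R a (k * a - 1))%:E.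
Proof.
case: a ha => // a _.
exists (flow_dim k a), (@base_flow R k a), (@basis_flow k a); split.
- exact: base_flow_affine_hull.
- exact: unit_flow_lattice_basis.
rewrite flow_polytope_linked_chains // lebesgue_linked_chains //.
by rewrite source_rank_dim // sink_rank_dim // -EFinM ballot_poly_Cat.
Qed.
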